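(* Let $G$ be an embedded graph in an oriented surface, with a checkerboard colouring of its faces (faces coloured black and white so that faces sharing an edge have different colours). Then \[ P(G;\lambda)=(-1)^{f(G)}\, j(\vec{G}_m^P;-\lambda), \] where $f(G)$ is the number of faces of $G$.
   Context: The medial graph $G_m$ has a degree-4 vertex $v_e$ on each edge $e$ of $G$, with edges following the face boundaries of $G$ (an isolated vertex contributes a vertex-free closed curve); faces of $G_m$ containing a vertex of $G$ are coloured black, others white (canonical colouring). At $v_e$: the white split pairs consecutive half-edges bounding white corners, the black split those bounding black corners, the crossing pairs opposite half-edges. A state $s$ chooses a vertex state at each vertex; $c(s)$ = number of resulting closed curves, $cr(s)$ = number of crossings; Penrose states have no black split; the Penrose polynomial is $P(G;\lambda)=\sum_{s\text{ Penrose}}(-1)^{cr(s)}\lambda^{c(s)}$. The Penrose directed medial graph $\vec{G}_m^P$ is $G_m$ with each edge directed (using the orientation of the surface) clockwise as it follows the boundary of a white face of $G$ and counterclockwise as it follows a black face of $G$ (colours from the given checkerboard colouring of $G$). For a 4-regular Eulerian digraph $\vec{H}$, the circuit partition polynomial is $j(\vec{H};x)=\sum_s x^{c(s)}$, summed over the states $s$ of the underlying graph in which, at every vertex, each of the two pairs consists of one incoming and one outgoing half-edge. *)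

(* Defs.v *)
From mathcomp Require Import all_boot all_order all_algebra all_fingroup.

Set Implicit Arguments.
Unset Strict Implicit.
Unset Printing Implicit Defensive.

Import GRing.Theory.
Local Open Scope ring_scope.

(* A graph cellularly embedded in an oriented (not necessarily connected)
   closed surface, given by its rotation system: [dart] is the set of
   half-edges, [dopp] exchanges the two halves of an edge, and [vrot] sends a
   half-edge to the next one counterclockwise around its end-vertex, so that
   the cycles of [vrot] are the vertices carrying at least one half-edge. A
   vertex outside the image of [tail] is isolated: it is alone on a sphere. *)
Record embGraph := EmbGraph {
  vert : finType;
  dart : finType;
  tail : dart -> vert;
  dopp : {perm dart};
  vrot : {perm dart};
  doppK : involutive dopp;
  dopp_neq : forall d, dopp d != d;
  tail_vrot : forall d d', (tail d == tail d') = (d' \in porbit vrot d)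
}.
Arguments tail {e}.
Arguments dopp {e}.
Arguments vrot {e}.

Lemma mem_porbits (T : finType) (p : {perm T}) (x : T) :
  porbit p x \in porbits p.
Proof. exact: imset_f. Qed.

Section EmbeddedGraph.
Variable G : embGraph.
Implicit Types d : dart G.

Definition edge : finType := {e : {set dart G} | e \in porbits (@dopp G)}.

Definition edge_of d : edge := exist _ (porbit dopp d) (mem_porbits dopp d).

Definition isolated (v : vert G) : bool := v \notin codom (@tail G).

(* Walking along [d] away from its vertex with a face on the left, the next
   half-edge along the boundary of that face is [vrot^-1 (dopp d)]. *)
Definition face_perm : {perm dart G} := (dopp * vrot^-1)%g.

(* An isolated vertex has a single face, the rest of its sphere. *)
Definition face : finType :=
  ({A : {set dart G} | A \in porbits face_perm}
   + {v : vert G | isolated v})%type.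

Definition left_face d : face :=
  inl (exist _ (porbit face_perm d) (mem_porbits face_perm d)).

(* [true] is black. The two sides of the edge of [d] lie on [left_face d] and
   [left_face (dopp d)]. *)
Definition checkerboard (col : face -> bool) : Prop :=
  forall d, col (left_face d) != col (left_face (dopp d)).

End EmbeddedGraph.

(* 4-regular graphs, possibly with loops, multiple edges, and [free4]
   vertex-free closed curves. *)
Record graph4 := Graph4 {
  vert4 : finType;
  half4 : finType;
  at4 : half4 -> vert4;
  opp4 : half4 -> half4;
  free4 : nat;
  opp4K : involutive opp4;
  opp4_neq : forall h, opp4 h != h;
  deg4 : forall v, #|[set h | at4 h == v]| = 4%N
}.
Arguments at4 {g}.
Arguments opp4 {g}.

Section States.
Variable H : graph4.

(* A vertex state is a partition into two pairs of the four half-edges at the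
   vertex; a state is encoded as the map sending each half-edge to its
   partner. *)
Definition is_state (s : {ffun half4 H -> half4 H}) : bool :=
  [forall h, [&& s (s h) == h, s h != h & at4 (s h) == at4 h]].

Definition ncurves (s : {ffun half4 H -> half4 H}) : nat :=
  (n_comp [rel h k | (k == opp4 h) || (k == s h)] (half4 H) + free4 H)%N.

End States.

(* [out4 h]: the half-edge [h] is outgoing at its vertex. *)
Record digraph4 := Digraph4 {
  under4 :> graph4;
  out4 : half4 under4 -> bool;
  out4_opp : forall h, out4 (opp4 h) = ~~ out4 h;
  eulerian4 : forall v : vert4 under4,
    #|[set h | (at4 h == v) && out4 h]| = #|[set h | (at4 h == v) && ~~ out4 h]|
}.
Arguments out4 {d}.

Definition circuit_partition (H : digraph4) : {poly int} :=
  \sum_(s : {ffun half4 H -> half4 H} |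
          is_state s && [forall h, out4 (s h) != out4 h])
    'X^(ncurves s).

Section Medial.
Variable G : embGraph.

(* The medial half-edge [(d, true)] (resp. [(d, false)]) leaves the midpoint of
   the edge of [d] towards the end-vertex of [d], on the left (resp. right) of
   [d] when looking along [d] from that end-vertex. *)
Definition mhalf : finType := (dart G * bool)%type.

Definition mat (h : mhalf) : edge G := edge_of h.1.

(* The medial edges are the corners of G: the corner from [d] to [vrot d]
   carries [(d, true)] and [(vrot d, false)]. *)
Definition mopp (h : mhalf) : mhalf :=
  if h.2 then (vrot h.1, false) else ((vrot^-1)%g h.1, true).

Lemma moppK : involutive mopp.
Proof. by case=> d []; rewrite /mopp /= ?permK ?permKV. Qed.

Lemma mopp_neq h : mopp h != h.
Proof. by case: h => d []; rewrite /mopp xpair_eqE andbF. Qed.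

Lemma edge_of_eq (d d' : dart G) :
  (edge_of d == edge_of d') = (d == d') || (d == dopp d').
Proof.
rewrite -val_eqE /= eq_porbit_mem; apply/idP/orP.
  case/porbitP=> i ->; elim: i => [|i [] /eqP IH].
  - by left; rewrite expg0 perm1.
  - by right; rewrite expgSr permM IH.
  - by left; rewrite expgSr permM IH doppK.
by case=> /eqP ->; rewrite ?porbit_id //; apply/porbitP; exists 1%N.
Qed.

Lemma edgeP (e : edge G) : exists d, e = edge_of d.
Proof.
case: e => A PA; have /imsetP[d _ eA] := PA.
by exists d; apply/val_inj.
Qed.

Lemma medial_at (d : dart G) (P : pred mhalf) :
  #|[set h | (mat h == edge_of d) && P h]| =
  (P (d, true) + P (d, false) + P (dopp d, true) + P (dopp d, false))%N.
Proof.
have nd : (d == dopp d) = false by rewrite eq_sym (negPf (dopp_neq d)).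
rewrite -sum1dep_card big_mkcondr /=.
rewrite (eq_bigl
  [in [:: (d, true); (d, false); (dopp d, true); (dopp d, false)]]); last first.
  by case=> x []; rewrite /mat edge_of_eq !inE !xpair_eqE ?andbT ?andbF ?orbF.
rewrite -big_uniq /=; last by rewrite !inE !xpair_eqE nd !andbF.
rewrite !big_cons big_nil.
by case: (P _); case: (P _); case: (P _); case: (P _).
Qed.

Lemma medial_deg e : #|[set h | mat h == e]| = 4%N.
Proof.
case: (edgeP e) => d ->.
by apply: etrans (medial_at d predT); apply: eq_card => h; rewrite !inE andbT.
Qed.

Definition medial : graph4 :=
  Graph4 #|@isolated G| moppK mopp_neq medial_deg.

(* The counterclockwise rotation at a medial vertex. *)
Definition mrot (h : mhalf) : mhalf :=
  if h.2 then (h.1, false) else (dopp h.1, true).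

(* The corner between [h] and [mrot h] at a medial vertex is the one between
   the two medial half-edges flanking [d] when [h = (d, true)], whose medial
   face contains the end-vertex of [d]; when [h = (d, false)] it is the corner
   to the right of [d], whose medial face lies inside a face of G. *)
Definition black_corner (h : mhalf) : bool := h.2.

Definition white_split (s : {ffun mhalf -> mhalf}) (e : edge G) : bool :=
  [forall h, (mat h == e) ==> ~~ black_corner h ==> (s h == mrot h)].

Definition black_split (s : {ffun mhalf -> mhalf}) (e : edge G) : bool :=
  [forall h, (mat h == e) ==> black_corner h ==> (s h == mrot h)].

Definition crossing (s : {ffun mhalf -> mhalf}) (e : edge G) : bool :=
  [forall h, (mat h == e) ==> (s h == mrot (mrot h))].

Definition ncross (s : {ffun mhalf -> mhalf}) : nat :=
  #|[set e | crossing s e]|.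

Definition penrose_state (s : {ffun half4 medial -> half4 medial}) : bool :=
  is_state s && [forall e, ~~ black_split s e].

Definition penrose : {poly int} :=
  \sum_(s : {ffun half4 medial -> half4 medial} | penrose_state s)
    (-1) ^+ ncross s *: 'X^(ncurves s).

(* The face of G whose boundary is followed by the medial edge of [h]. *)
Definition mface (h : mhalf) : face G :=
  left_face (if h.2 then h.1 else dopp h.1).

(* Counterclockwise around a face means keeping it on the left. In the corner
   from [d] to [vrot d] this enters along the edge of [vrot d] and leaves along
   [d], so that the medial half-edge [(vrot d, false)] is outgoing and
   [(d, true)] is incoming when the face is black. *)
Definition mout (col : face G -> bool) (h : mhalf) : bool :=
  if col (mface h) then ~~ h.2 else h.2.

Lemma mface_opp h : mface (mopp h) = mface h.
Proof.
case: h => d b; congr inl; apply/val_inj => /=; apply/eqP.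
rewrite eq_porbit_mem.
case: b => /=.
  rewrite porbit_sym; apply/porbitP; exists 1%N.
  by rewrite expg1 permM doppK permK.
by apply/porbitP; exists 1%N; rewrite expg1 permM doppK.
Qed.

Lemma mout_opp col h : mout col (mopp h) = ~~ mout col h.
Proof.
by rewrite /mout mface_opp; case: h => d []; case: (col _).
Qed.

Lemma mout_eulerian col : checkerboard col -> forall e,
  #|[set h | (mat h == e) && mout col h]| =
  #|[set h | (mat h == e) && ~~ mout col h]|.
Proof.
move=> colP e; case: (edgeP e) => d ->.
rewrite (medial_at d (mout col)) (medial_at d (fun h => ~~ mout col h)).
rewrite /mout /mface /= doppK.
by have := colP d; case: (col _); case: (col _).
Qed.

Definition penrose_digraph (col : face G -> bool) (colP : checkerboard col) :
    digraph4 :=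
  @Digraph4 medial (mout col) (mout_opp col) (mout_eulerian colP).

End Medial.

(* Main.v *)
Require Import Defs.
From mathcomp Require Import all_boot all_order all_algebra all_fingroup.
Local Open Scope ring_scope.

(** For the Penrose orientation the white split and the crossing are the two
    consistently oriented vertex states, so the Penrose states are the states
    of the directed medial graph. Following the
    orientation, a state becomes a permutation of the corners of G (i.e. of its
    darts) whose cycles are the closed curves. For the all-white state these
    cycles are the faces of G, and turning a white split into a crossing
    multiplies the permutation by a transposition. Comparing signs,
    c(s) + f(G) and cr(s) have the same parity. *)

Set Implicit Arguments.
Unset Strict Implicit.
Unset Printing Implicit Defensive.
Import GRing.Theory.

(** * Orbits of permutations and products of transpositions *)

Lemma porbit_fconnect (T : finType) (p : {perm T}) (x y : T) :
  (y \in porbit p x) = fconnect p x y.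
Proof.
apply/porbitP/idP => [[i ->]|/iter_findex <-].
  by rewrite permX fconnect_iter.
by exists (findex p x y); rewrite permX.
Qed.

Lemma card_porbits (T : finType) (p : {perm T}) : #|porbits p| = fcard p T.
Proof.
have symp := fconnect_sym (@perm_inj _ p).
rewrite /n_comp_mem.
rewrite -(@card_in_imset _ _ (porbit p)); last first.
  move=> x y; rewrite !inE !andbT => /eqP rx /eqP ry /eqP.
  rewrite eq_porbit_mem porbit_fconnect => /(fingraph.rootP symp).
  by rewrite rx ry.
apply: eq_card => A; apply/imsetP/imsetP => [[x _ ->]|[x _ ->]]; last by exists x.
exists (froot p x); first by rewrite !inE roots_root.
by apply/eqP; rewrite eq_porbit_mem porbit_fconnect symp connect_root.
Qed.

(** As [q] is injective and leads out of [B], the pairs [b], [q b] are disjoint for distinct [b] in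
    [r], so the transpositions act independently. *)
Lemma prod_tperm_shift (T : finType) (B : pred T) (q : {perm T}) (r : seq T) :
    (forall x, B x -> ~~ B (q x)) -> uniq r -> all B r ->
  forall x, (\prod_(b <- r) tperm b (q b))%g x =
    if x \in r then q x else
    if (q^-1)%g x \in r then (q^-1)%g x else x.
Proof.
move=> BqN; elim: r => [|b r IHr] /=; first by move=> _ _ x; rewrite big_nil perm1.
case/andP=> bNr Ur /andP[Bb Br] x; have /allP rB := Br.
have qN y : B y -> ((q^-1)%g y \in r) = false.
  by move=> By; apply/negP => /rB/BqN; rewrite permKV By.
have Nr y : ~~ B y -> (y \in r) = false.
  by move=> By; apply/negP => /rB; rewrite (negPf By).
rewrite big_cons permM (IHr Ur Br) !inE.
case: tpermP => [->|->|/eqP xb /eqP xqb].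
- by rewrite eqxx (Nr _ (BqN _ Bb)) permK (negPf bNr).
- rewrite (negPf bNr) (qN _ Bb) permK eqxx (Nr _ (BqN _ Bb)) orbF.
  by case: eqP => // qbb; have := BqN _ Bb; rewrite qbb Bb.
rewrite (negPf xb) /=; case: ifP => // _.
suff -> : ((q^-1)%g x == b) = false by [].
by apply/negP => /eqP qx; move: xqb; rewrite -qx permKV eqxx.
Qed.

Lemma odd_prod_tperm_shift (T : finType) (B : pred T) (q : {perm T}) (r : seq T) :
    (forall x, B x -> ~~ B (q x)) -> all B r ->
  odd_perm (\prod_(b <- r) tperm b (q b))%g = odd (size r).
Proof.
move=> BqN; elim: r => [|b r IHr] /=; first by rewrite big_nil odd_perm1.
case/andP=> Bb Br; rewrite big_cons odd_mul_tperm IHr //.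
by case: eqP (BqN _ Bb) => [<-|]; rewrite ?Bb.
Qed.

(** * The three states at a medial vertex *)

Section MedialStates.
Variable G : embGraph.
Implicit Types (d : dart G) (h : mhalf G) (s : {ffun mhalf G -> mhalf G}).

Lemma mat_dopp d b c : mat (dopp d, b) = mat (d, c).
Proof. by apply/eqP; rewrite /mat edge_of_eq eqxx orbT. Qed.

(** The four half-edges at the vertex are flagged copies of [d] and [dopp d]; each of their three
    pairings is a single formula in [h], the same for both darts. *)
Variant medial_state_at s (d : dart G) : Prop :=
| WhiteAt of forall h, mat h = edge_of d -> s h = (dopp h.1, ~~ h.2)
| CrossAt of forall h, mat h = edge_of d -> s h = (dopp h.1, h.2)
| BlackAt of forall h, mat h = edge_of d -> s h = (h.1, ~~ h.2).

Lemma mat_edgeP (d : dart G) h : mat h = edge_of d -> h.1 = d \/ h.1 = dopp d.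
Proof.
by move/eqP; rewrite /mat edge_of_eq => /orP[] /eqP ->; [left|right].
Qed.

Lemma is_stateP s : is_state (H := medial G) s ->
  [/\ involutive s, forall h, s h <> h & forall h, mat (s h) = mat h].
Proof.
move/forallP=> st; split=> h; case/and3P: (st h) => /eqP ? /eqP ? /eqP //.
Qed.

Lemma medial_stateP s d : is_state (H := medial G) s -> medial_state_at s d.
Proof.
case/is_stateP=> sK sN sm.
have dN : dopp d <> d by apply/eqP; exact: dopp_neq.
have sv (h : mhalf G) : mat h = edge_of d ->
    [\/ s h = (dopp h.1, ~~ h.2), s h = (dopp h.1, h.2) | s h = (h.1, ~~ h.2)].
  move=> hd; have := sm h; have := sN h; rewrite /mat.
  case: (s h) => x c /= xN /eqP; rewrite edge_of_eq => /orP[] /eqP xh.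
    apply: Or33; rewrite xh; congr pair; move: xN; rewrite xh.
    by case: h {hd xh} => y [] /=; case: c.
  by rewrite xh; case: (eqVneq c h.2) => [->|]; [apply: Or32|];
     case: c {xN}; case: h.2 => // _; apply: Or31.
have mt b : mat (d, b) = edge_of d by [].
have mt' b : mat (dopp d, b) = edge_of d by rewrite (mat_dopp _ _ b).
have := sv _ (mt true); have := sv _ (mt false).
have := sv _ (mt' true); have := sv _ (mt' false).
have k1 := sK (d, true); have k2 := sK (d, false).
have k3 := sK (dopp d, true); have k4 := sK (dopp d, false).
(* Three possible partners for each half-edge give 81 combinations; involutivity leaves only the
   three uniform ones. *)
rewrite /= doppK => -[] e4 [] e3 [] e2 [] e1;
  move: k1 k2 k3 k4; rewrite ?(e1, e2, e3, e4) => k1 k2 k3 k4;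
  first [ by case: k1 => ?; congruence | by case: k2 => ?; congruence
        | by case: k3 => ?; congruence | by case: k4 => ?; congruence | idtac ];
  [apply: WhiteAt | apply: CrossAt | apply: BlackAt];
  case=> x c /mat_edgeP /= [] ->; rewrite ?doppK;
  by case: c; rewrite ?(e1, e2, e3, e4).
Qed.

(** The partner of one half-edge decides the state of the whole vertex. *)
Lemma crossing_edge_of s d : is_state (H := medial G) s ->
  crossing s (edge_of d) = (s (d, true) == (dopp d, true)).
Proof.
move=> st; have mt : mat (d, true) = edge_of d by [].
apply/forallP/eqP => [/(_ (d, true))|sd h]; first by rewrite /mat eqxx => /eqP.
apply/implyP => /eqP hd; case: (medial_stateP d st) => H.
- by move: sd; rewrite H.
- by rewrite H //; case: h {hd} => x [].
- move: sd; rewrite H //= => -[]; congruence.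
Qed.

Lemma black_split_edge_of s d : is_state (H := medial G) s ->
  black_split s (edge_of d) = (s (d, true) == (d, false)).
Proof.
move=> st; have mt : mat (d, true) = edge_of d by [].
apply/forallP/eqP => [/(_ (d, true))|sd h]; first by rewrite /mat eqxx => /eqP.
apply/implyP => /eqP hd; apply/implyP; rewrite /black_corner /mrot.
case: (medial_stateP d st) => H.
- by case: (sd); rewrite H //= => -[] /eqP; rewrite (negPf (dopp_neq d)).
- by case: (sd); rewrite H.
- by rewrite H //; case: h {hd} => x [].
Qed.

End MedialStates.

(** * Colours and directions of medial half-edges *)

Section Checkerboard.
Variables (G : embGraph) (col : face G -> bool).
Hypothesis colP : checkerboard col.
Implicit Types (d : dart G) (h : mhalf G) (s : {ffun mhalf G -> mhalf G}).

Let blk d := col (left_face d).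

Lemma blk_dopp d : blk (dopp d) = ~~ blk d.
Proof. by have := colP d; rewrite /blk; case: (col _); case: (col _). Qed.

(** The corner between [d] and [vrot d] lies to the left of [d] and to the right of [vrot d], so
    colours alternate around a vertex. *)
Lemma blk_vrot d : blk (vrot d) = ~~ blk d.
Proof.
have := mface_opp (d, true); rewrite /mface /= => e.
by rewrite -[RHS]/(~~ col (left_face d)) -e -[col _]/(blk _) blk_dopp negbK.
Qed.

Lemma blk_vrotV d : blk ((vrot^-1)%g d) = ~~ blk d.
Proof. by rewrite -{2}[d](permKV vrot) blk_vrot negbK. Qed.

(** The two sides of a dart have opposite colours, which makes both medial half-edges flanking it
    point the same way. *)
Lemma moutE h : mout col h = ~~ blk h.1.
Proof.
rewrite /mout /mface; case: h => d [] /=; rewrite -/(blk _) ?blk_dopp.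
  by case: (blk d).
by case: (blk d).
Qed.

Definition consistent s := [forall h, mout col (s h) != mout col h].

(** The black split pairs the two half-edges of one dart, which have equal directions; the other two
    states pass to [dopp] of the dart, where the direction is opposite. *)
Lemma penrose_stateE s :
  penrose_state s = is_state (H := medial G) s && consistent s.
Proof.
rewrite /penrose_state; case st: (is_state _) => //=.
apply/forallP/forallP => [nb h|co e].
  have := nb (edge_of h.1); rewrite black_split_edge_of // => /eqP sd.
  rewrite !moutE; case: (medial_stateP h.1 st) => H.
  - by rewrite H //= blk_dopp; case: (blk _).
  - by rewrite H //= blk_dopp; case: (blk _).
  - by case: sd; rewrite H.
case: (edgeP e) => d ->; rewrite black_split_edge_of //; apply/eqP => sd.
by have := co (d, true); rewrite !moutE sd /= eqxx.
Qed.

(** The medial edge of [h] runs in the corner from some [d] to [vrot d] and is named by that [d]. *)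
Definition corner h : dart G := if h.2 then h.1 else (vrot^-1)%g h.1.

(* The incoming half-edge of the medial edge in the corner from [d] to
   [vrot d]. *)
Definition corner_in d : mhalf G := if blk d then (d, true) else (vrot d, false).

Lemma corner_inK : cancel corner_in corner.
Proof. by move=> d; rewrite /corner_in /corner; case: (blk d); rewrite //= permK. Qed.

Lemma corner_mopp h : corner (mopp h) = corner h.
Proof. by case: h => d []; rewrite /corner /mopp //= permK. Qed.

Lemma mout_corner_in d : mout col (corner_in d) = false.
Proof.
by rewrite moutE /corner_in; case b: (blk d); rewrite /= ?blk_vrot b.
Qed.

Lemma cornerK h : ~~ mout col h -> corner_in (corner h) = h.
Proof.
rewrite moutE negbK; case: h => d [] /= bd; rewrite /corner /corner_in /=.
  by rewrite bd.
by rewrite blk_vrotV bd permKV.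
Qed.

Lemma mopp_out h : mout col h -> mopp h = corner_in (corner h).
Proof. by move=> ho; rewrite -corner_mopp cornerK // mout_opp negbK. Qed.

(** * Closed curves of a state as cycles of a permutation *)

Section OneState.
Variable s : {ffun mhalf G -> mhalf G}.
Hypotheses (st : is_state (H := medial G) s) (co : consistent s).

Let sK : involutive s. Proof. by case: (is_stateP st). Qed.

Lemma mout_state h : mout col (s h) = ~~ mout col h.
Proof. by have := forallP co h; case: (mout _ _); case: (mout _ _). Qed.

Lemma corner_in_next d :
  corner_in (corner (s (corner_in d))) = mopp (s (corner_in d)).
Proof. by rewrite mopp_out // mout_state mout_corner_in. Qed.

Lemma next_corner_inj : injective (fun d => corner (s (corner_in d))).
Proof.
move=> x y /(congr1 corner_in); rewrite !corner_in_next.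
move/(can_inj (@moppK G))/(can_inj sK); exact: (can_inj corner_inK).
Qed.

(** One step along a directed curve: enter a vertex from a corner, pass through it by [s], and name
    the corner by which the curve leaves. *)
Definition next_corner : {perm dart G} := perm next_corner_inj.

Lemma next_cornerE d : next_corner d = corner (s (corner_in d)).
Proof. exact: permE. Qed.

(** [corner_in] selects one half-edge of each medial edge; a step of [next_corner] is then [s]
    followed by [mopp]. *)
Lemma ncurves_porbits :
  ncurves (H := medial G) s = (#|porbits next_corner| + #|@isolated G|)%N.
Proof.
rewrite /ncurves card_porbits; congr addn.
set e := [rel h k | _].
have syme : connect_sym e.
  apply: sym_connect_sym => h k /=.
  by congr orb; apply/eqP/eqP => ->; rewrite ?sK ?(@moppK G).
have symp := fconnect_sym (@perm_inj _ next_corner).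
rewrite (@adjunction_n_comp _ _ corner_in e (frel next_corner)) //.
split=> [h _|x y _].
  exists (corner h); case ho: (mout col h); last by rewrite cornerK ?ho.
  by rewrite -mopp_out //; apply: connect1; rewrite /= eqxx.
apply/idP/idP.
  case/connectP=> p; elim: p x => [|z p IHp] x /=; first by move=> _ ->.
  case/andP=> /eqP <- pp yl; apply: connect_trans (IHp _ pp yl).
  rewrite next_cornerE corner_in_next.
  apply: (@connect_trans _ _ (s (corner_in x))); apply: connect1.
    by rewrite /= eqxx orbT.
  by rewrite /= eqxx.
(* Conversely, [corner] is constant along [mopp] and moves one step forwards or backwards along [s],
   depending on the direction of [h]. *)
suff H h k : connect e h k -> fconnect next_corner (corner h) (corner k).
  by move/H; rewrite !corner_inK.
case/connectP=> p; elim: p h => [|z p IHp] h /=; first by move=> _ ->.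
case/andP=> hz pp kl; apply: connect_trans (IHp _ pp kl).
case/orP: hz => /eqP ->; first by rewrite (corner_mopp h).
case ho: (mout col h); last first.
  by apply: connect1; rewrite /= next_cornerE cornerK ?ho.
rewrite symp; apply: connect1; rewrite /= next_cornerE cornerK ?sK //.
by rewrite mout_state ho.
Qed.

End OneState.

(** * The all-white state traces the faces *)

Definition all_white : {ffun mhalf G -> mhalf G} := [ffun h => (dopp h.1, ~~ h.2)].

Lemma all_white_state : is_state (H := medial G) all_white.
Proof.
apply/forallP=> -[d b]; rewrite !ffunE /= doppK negbK eqxx /= xpair_eqE.
by rewrite (negPf (dopp_neq d)) /=; apply/eqP; exact: mat_dopp.
Qed.

Lemma all_white_consistent : consistent all_white.
Proof.
by apply/forallP=> h; rewrite ffunE !moutE /= blk_dopp; case: (blk _).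
Qed.

Let face_next := next_corner all_white_state all_white_consistent.

(** Black faces are followed counterclockwise, as [face_perm] does, and white faces clockwise. *)
Lemma face_nextE d :
  face_next d = if blk d then face_perm G d else ((face_perm G)^-1)%g d.
Proof.
rewrite next_cornerE /corner_in /corner ffunE; case: (blk d) => /=.
  by rewrite permM.
apply: (@perm_inj _ (face_perm G)).
by rewrite permKV permM doppK permK.
Qed.

Lemma blk_face_perm d : blk (face_perm G d) = blk d.
Proof. by rewrite permM blk_vrotV blk_dopp negbK. Qed.

(** Colour is constant along each face, so [face_next] runs through the whole orbit in one sense,
    and reversing a cycle keeps its support. *)
Lemma porbits_face_next : porbits face_next = porbits (face_perm G).
Proof.
have blkV x : blk (((face_perm G)^-1)%g x) = blk x.
  by rewrite -blk_face_perm permKV.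
apply: eq_imset => d.
pose q := if blk d then face_perm G else ((face_perm G)^-1)%g.
have -> : porbit (face_perm G) d = porbit q d.
  by rewrite /q; case: (blk d); rewrite ?porbitV.
have qb x : blk (q x) = blk x.
  by rewrite /q; case: (blk d); rewrite ?blk_face_perm ?blkV.
have qi i : blk ((q ^+ i)%g d) = blk d /\ (face_next ^+ i)%g d = (q ^+ i)%g d.
  elim: i => [|i [IHb IHi]]; first by rewrite !expg0 perm1.
  rewrite !expgSr !permM IHi face_nextE qb IHb /q.
  by case: (blk d).
apply/setP => y; apply/porbitP/porbitP => -[i ->]; exists i;
  by case: (qi i).
Qed.

(** * Parity of the number of curves *)

Section Parity.
Variable s : {ffun mhalf G -> mhalf G}.
Hypotheses (st : is_state (H := medial G) s) (co : consistent s).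

(** Exactly one of the two darts of an edge is black; it represents the crossed edge. *)
Let cross_darts : {set dart G} :=
  [set d | blk d && (s (d, true) == (dopp d, true))].

Lemma ncross_card : ncross s = #|cross_darts|.
Proof.
rewrite /ncross -(@card_in_imset _ _ (@edge_of G)); last first.
  move=> x y; rewrite !inE => /andP[bx _] /andP[by_ _] /eqP.
  rewrite edge_of_eq => /orP[] /eqP // xy.
  by move: bx; rewrite xy blk_dopp by_.
apply: eq_card => e; rewrite inE; apply/idP/imsetP => [|[d dA ->]]; last first.
  by move: dA; rewrite inE crossing_edge_of // => /andP[].
case: (edgeP e) => d -> cd; case bd: (blk d).
  by exists d; rewrite // inE bd -crossing_edge_of.
have ed : edge_of d = edge_of (dopp d).
  by apply/eqP; rewrite edge_of_eq doppK eqxx orbT.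
by exists (dopp d); rewrite // inE blk_dopp bd -crossing_edge_of // -ed.
Qed.

(* At the crossing on a black dart [d], the two incoming half-edges are
   [(d, true)] and [(d, false)], lying in the corners [d] and [vrot^-1 d]. *)
Lemma next_corner_tperm :
  next_corner st co =
  (\prod_(d <- enum cross_darts) tperm d ((vrot^-1)%g d) * face_next)%g.
Proof.
apply/permP => d; rewrite permM (@prod_tperm_shift _ blk) ?enum_uniq //; last 2 first.
- by move=> x bx; rewrite blk_vrotV bx.
- by apply/allP=> x; rewrite mem_enum inE => /andP[].
rewrite invgK !mem_enum !inE blk_vrot !next_cornerE.
case bd: (blk d) => /=.
  have dE : corner_in d = (d, true) by rewrite /corner_in bd.
  have vE : corner_in ((vrot^-1)%g d) = (d, false).
    by rewrite /corner_in blk_vrotV bd permKV.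
  (* A crossing sends [(d, true)] to where the white split sends [(d, false)]. *)
  case: eqP => sd; first by rewrite vE dE sd ffunE.
  rewrite dE ffunE /=; case: (medial_stateP d st) => H.
  - by rewrite H.
  - by case: sd; rewrite H.
  - have := forallP co (d, true); rewrite !moutE H //= eqxx //.
(* The corner of a white [d] enters at [(vrot d, false)], so the crossing to test is that of the
   black dart [vrot d]. *)
set x := vrot d; have bx : blk x by rewrite blk_vrot bd.
have dE : corner_in d = (x, false) by rewrite /corner_in bd.
have xE : corner_in x = (x, true) by rewrite /corner_in bx.
rewrite dE; case: (medial_stateP x st) => H.
- by rewrite !H // xpair_eqE andbF dE ffunE.
- by rewrite !H // eqxx xE ffunE.
- by have := forallP co (x, true); rewrite !moutE H //= eqxx.
Qed.

Lemma odd_ncurves : odd (ncurves (H := medial G) s) = odd (#|face G| + ncross s).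
Proof.
have cf : #|face G| = (#|porbits face_next| + #|@isolated G|)%N.
  by rewrite card_sum !card_sig porbits_face_next.
have := congr1 (@odd_perm _) next_corner_tperm.
rewrite odd_permM (@odd_prod_tperm_shift _ blk); last 2 first.
- by move=> x bx; rewrite blk_vrotV bx.
- by apply/allP=> x; rewrite mem_enum inE => /andP[].
(* The sign of a permutation is the parity of the number of points plus the number of orbits; the
   number of darts cancels between the two sides. *)
rewrite -cardE -ncross_card (ncurves_porbits st co) cf !oddD /odd_perm.
by do 5!case: (odd _).
Qed.

End Parity.

End Checkerboard.

Theorem theorem6p2 (G : embGraph) (col : face G -> bool)
    (colP : checkerboard col) :
  penrose G =
    (-1) ^+ #|face G| *: (circuit_partition (penrose_digraph colP) \Po (- 'X)).
Proof.
rewrite /penrose /circuit_partition raddf_sum /= scaler_sumr.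
rewrite (eq_bigl _ _ (penrose_stateE colP)).
apply: eq_bigr => s /andP[st co].
rewrite comp_Xn_poly -scaleN1r exprZn scalerA -exprD; congr (_ *: _).
rewrite -signr_odd -[RHS]signr_odd oddD (odd_ncurves colP st co) oddD.
by case: (odd _); case: (odd _).
Qed.
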